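(* Let $X$ be a real Banach space, let $Y$ be a reflexive closed linear subspace of $X$, and let $Z$ be a closed linear subspace of $X$ such that $Y+Z$ is closed and $(X,Z,\mathcal{F}(X))$ has weak-$\mathscr{F}_{cmc}$-SACP. Then $(X,Y+Z,\mathcal{F}(X))$ has weak-$\mathscr{F}_{cmc}$-SACP.
   Context: All Banach spaces are real. $\mathcal{F}(X)$ is the set of all nonempty finite subsets of $X$. $\mathscr{F}_{cmc}$ is the class of all functions $f:\mathbb{R}^N_+\to\mathbb{R}_+$, $N\in\mathbb{N}$, that are convex, monotone ($\varphi_1\le\varphi_2$ coordinatewise implies $f(\varphi_1)\le f(\varphi_2)$) and coercive ($f(\varphi)\to\infty$ as $\|\varphi\|_\infty\to\infty$). For $x\in X$, a weakly closed subset $V\subseteq X$, $F=\{x_1,\dots,x_N\}\in\mathcal{F}(X)$ and $f:\mathbb{R}^N_+\to\mathbb{R}_+$: $r_f(x,F)=f(\|x-x_1\|,\dots,\|x-x_N\|)$ and $\mathrm{rad}_V^f(F)=\inf_{v\in V}r_f(v,F)$. The triplet $(X,V,\mathcal{F}(X))$ has weak-$\mathscr{F}_{cmc}$-SACP ($\mathscr{F}_{cmc}$-simultaneous approximative weak-compactness property) if for every $F=\{x_1,\dots,x_N\}\in\mathcal{F}(X)$ and every $f:\mathbb{R}^N_+\to\mathbb{R}_+$ in $\mathscr{F}_{cmc}$, every sequence $(v_n)\subseteq V$ with $r_f(v_n,F)\to\mathrm{rad}_V^f(F)$ has a weakly convergent subsequence. *)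

(* Defs.v *)
From HB Require Import structures.
From mathcomp Require Import all_boot all_order all_algebra.
From mathcomp Require Import all_classical all_reals all_analysis.

Set Implicit Arguments.
Unset Strict Implicit.
Unset Printing Implicit Defensive.

Import Order.TTheory GRing.Theory Num.Theory.
Import numFieldNormedType.Exports.

Local Open Scope classical_set_scope.
Local Open Scope ring_scope.

Section subspaces.
Context {R : realType} {X : normedModType R}.
Implicit Types Y Z : set X.

Definition closed_subspace Y : Prop :=
  submod_closed [in Y] /\ closed Y.

Definition set_sum Y Z : set X := [set y + z | y in Y & z in Z].

(** An element of [Y^*] is represented by any function on [X] whose restriction
    to [Y] is linear and bounded; the values off [Y] are irrelevant. *)
Definition linear_on Y (f : X -> R) : Prop :=
  forall (a : R) (u v : X), Y u -> Y v -> f (a *: u + v) = a * f u + f v.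

Definition dual Y : set (X -> R) :=
  [set f | linear_on Y f /\
           exists C : R, forall y, Y y -> `|f y| <= C * `|y| ].

Definition dual_norm Y (f : X -> R) : R :=
  sup [set `|f y| | y in Y `&` [set y | `|y| <= 1]].

(** Functions that agree on [Y] differ by an element of [dual_norm] zero, so
    linearity and boundedness force an element of the bidual to respect the
    representation of [Y^*] above. *)
Definition bidual Y : set ((X -> R) -> R) :=
  [set Phi |
    (forall (a : R) (f g : X -> R), dual Y f -> dual Y g ->
       Phi (fun x => a * f x + g x) = a * Phi f + Phi g) /\
    exists C : R, forall f, dual Y f -> `|Phi f| <= C * dual_norm Y f ].

(** The canonical embedding of [Y] into its bidual is onto. *)
Definition reflexive_subspace Y : Prop :=
  forall Phi, bidual Y Phi ->
  exists2 y, Y y & forall f, dual Y f -> Phi f = f y.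

Definition weakly_cvg_to (u : nat -> X) (l : X) : Prop :=
  forall phi : {linear X -> R^o}, continuous phi ->
  (fun n => phi (u n)) @ \oo --> phi l.

Definition has_weakly_cvg_subseq (u : nat -> X) : Prop :=
  exists (k : nat -> nat) (l : X),
    {homo k : m n / (m < n)%N} /\ weakly_cvg_to (u \o k) l.

End subspaces.

Section cmc.
Context {R : realType} {N : nat}.

Definition orthant : set 'rV[R]_N := [set phi | forall i, 0 <= phi 0 i].

(** A function on the orthant is given by a function on ['rV[R]_N] of which
    only the values on the orthant matter. The norm of ['rV[R]_N] is the
    sup norm. *)
Record cmc (f : 'rV[R]_N -> R) : Prop := {
  cmc_ge0 : forall phi, orthant phi -> 0 <= f phi ;
  cmc_convex : convex_function orthant f ;
  cmc_monotone : forall phi1 phi2, orthant phi1 -> orthant phi2 ->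
    (forall i, phi1 0 i <= phi2 0 i) -> f phi1 <= f phi2 ;
  cmc_coercive : forall M : R, exists K : R, forall phi, orthant phi ->
    K <= `|phi| -> M <= f phi
}.

End cmc.

Section sacp.
Context {R : realType} {X : normedModType R}.

Definition finite_nonempty (F : set X) : Prop := finite_set F /\ F !=set0.

Definition r_ N (f : 'rV[R]_N -> R) (v : X) (x : 'I_N -> X) : R :=
  f (\row_i `|v - x i|).

Definition rad (V : set X) N (f : 'rV[R]_N -> R) (x : 'I_N -> X) : R :=
  inf [set r_ f v x | v in V].

(** [r_] depends on the order in which [F] is listed, whence the quantification
    over all enumerations [x] without repetition of [F]. The property is meant
    for weakly closed [V], in particular for norm-closed subspaces. *)
Definition weak_cmc_SACP (V : set X) : Prop :=
  forall F : set X, finite_nonempty F ->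
  forall (N : nat) (x : 'I_N -> X), set_bij [set: 'I_N] F x ->
  forall f : 'rV[R]_N -> R, cmc f ->
  forall v : nat -> X, (forall n, V (v n)) ->
  (fun n => r_ f (v n) x) @ \oo --> rad V f x ->
  has_weakly_cvg_subseq v.

End sacp.

(* Main.v *)
Require Import Defs.
From mathcomp Require Import all_boot all_order all_algebra.
From mathcomp Require Import all_classical all_reals all_analysis.
From mathcomp Require Import ring lra.
From HB Require Import structures.

Set Implicit Arguments.
Unset Strict Implicit.
Unset Printing Implicit Defensive.

Import Order.TTheory GRing.Theory Num.Theory.
Import numFieldNormedType.Exports.

Local Open Scope classical_set_scope.
Local Open Scope ring_scope.

(** Coercivity makes a minimizing sequence in [Y + Z] bounded, and the open
    mapping theorem splits it as [y_n + z_n] with both summands bounded. By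
    reflexivity [y_n] tends weakly to some [b] in [Y] along a subsequence. By
    Mazur's theorem, convex combinations of tails of [(y_n, z_n)] yield pairs
    [(y'_n, z'_n)] with [y'_n] tending to [b] in norm, and convexity of [f]
    makes [z'_n] minimizing in [Z] for the translated set [F - b]; so [z'_n] has
    a weakly convergent subsequence. This applies to every subsequence of
    [z_n], and a bounded sequence all of whose subsequences have weakly
    convergent sequences of convex combinations of tails has itself a weakly
    convergent subsequence. *)

(** * The Hahn-Banach and Mazur theorems *)

Definition sublinear (R : realType) (V : lmodType R) (q : V -> R) : Prop :=
  (forall x y, q (x + y) <= q x + q y) /\
  (forall t x, 0 <= t -> q (t *: x) = t * q x).

Lemma sublinear0 (R : realType) (V : lmodType R) (q : V -> R) :
  sublinear q -> q 0 = 0.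
Proof. by move=> [_ /(_ 0 0 (lexx _))]; rewrite scale0r mul0r. Qed.

Lemma sublinear_geN (R : realType) (V : lmodType R) (q : V -> R) (x : V) :
  sublinear q -> - q (- x) <= q x.
Proof.
by move=> sq; rewrite -subr_ge0 opprK -(sublinear0 sq) -(subrr x) sq.1.
Qed.

(** No single [g i] need be sublinear: subadditivity and homogeneity hold only up to a change of
    index, which the infimum absorbs. This serves for chains in Zorn's lemma and for the explicit
    infima in the Hahn-Banach and separation theorems. *)
Lemma sublinear_inf (R : realType) (V : lmodType R) (I : Type) (A : set I)
    (g : I -> V -> R) :
  (exists2 i, A i & g i 0 = 0) ->
  (forall x, exists m, forall i, A i -> m <= g i x) ->
  (forall i, A i -> 0 <= g i 0) ->
  (forall i j x y, A i -> A j ->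
     exists2 k, A k & g k (x + y) <= g i x + g j y) ->
  (forall i t x, A i -> 0 < t -> exists2 k, A k & g k (t *: x) <= t * g i x) ->
  sublinear (fun x => inf [set g i x | i in A]).
Proof.
move=> [i0 Ai0 gi0] glb g0 gD gZ; set q := fun x => _.
have qle i x : A i -> q x <= g i x.
  move=> Ai; apply: ge_inf; last by exists i.
  by have [m mP] := glb x; exists m => _ [j Aj <-]; exact: mP.
have q_ge m x : (forall i, A i -> m <= g i x) -> m <= q x.
  move=> mg; apply: lb_le_inf; first by exists (g i0 x), i0.
  by move=> _ [j Aj <-]; exact: mg.
have qZ t x : 0 < t -> q (t *: x) <= t * q x.
  move=> t0; rewrite -ler_pdivrMl//; apply q_ge => i Ai.
  rewrite ler_pdivrMl//; have [k Ak] := gZ i t x Ai t0.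
  by apply: le_trans; exact: qle.
split.
- move=> x y; rewrite -lerBlDr; apply q_ge => i Ai.
  rewrite lerBlDr -lerBlDl; apply q_ge => j Aj.
  rewrite lerBlDl; have [k Ak] := gD i j x y Ai Aj.
  by apply: le_trans; exact: qle.
- move=> t x; rewrite le_eqVlt => /predU1P[<-|t0].
    rewrite scale0r mul0r; apply/eqP; rewrite eq_le; apply/andP; split.
      by rewrite -[leRHS]gi0 qle.
    by apply q_ge => i Ai; exact: g0.
  apply/eqP; rewrite eq_le qZ//=.
  (* The reverse inequality is [qZ] applied to [t^-1] and [t *: x]. *)
  rewrite -ler_pdivlMl//; apply: le_trans (qZ _ _ _); last by rewrite invr_gt0.
  by rewrite scalerA mulVf ?gt_eqF// scale1r.
Qed.

(** Zorn's lemma for the reversed pointwise order. The infimum of a nonempty chain is finite because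
    a sublinear [q <= p] satisfies [- p (- x) <= - q (- x) <= q x]; the empty chain is bounded by
    [p]. *)
Lemma minimal_sublinear (R : realType) (V : lmodType R) (p : V -> R) :
  sublinear p ->
  exists q, [/\ sublinear q, forall x, q x <= p x &
    forall q', sublinear q' -> (forall x, q' x <= q x) -> q' = q].
Proof.
move=> sp.
pose sub_p (q : V -> R) := sublinear q /\ forall x, q x <= p x.
pose T := {q : V -> R | sub_p q}.
pose rl (s t : T) := `[< forall x, sval t x <= sval s x >].
have [||||[q [sq qp]] qmin] := @Zorn T rl.
- by move=> s; apply/asboolP.
- move=> r s t /asboolP rs /asboolP st; apply/asboolP => x.
  exact: le_trans (st x) (rs x).
- move=> [s sP] [t tP] /asboolP /= st /asboolP /= ts.
  by apply: eq_exist; apply/funext => x; apply/eqP; rewrite eq_le ts st.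
- move=> A Atot; have [[s0 As0]|A0] := pselect (A !=set0); last first.
    exists (exist sub_p p (conj sp (fun=> lexx _))) => s As.
    by exfalso; apply: A0; exists s.
  have glb x : exists m, forall s, A s -> m <= sval s x.
    exists (- p (- x)) => -[s [ss sp']] _ /=.
    by apply: le_trans (sublinear_geN _ ss); rewrite lerN2.
  have sq : sublinear (fun x => inf [set sval s x | s in A]).
    apply: sublinear_inf => //.
    + by exists s0 => //; exact: sublinear0 (svalP s0).1.
    + by move=> s _; rewrite (sublinear0 (svalP s).1).
    + move=> s t x y As At; have [/asboolP st|/asboolP ts] := Atot s t As At.
        exists t => //; apply: le_trans ((svalP t).1.1 _ _) _.
        by rewrite lerD2r.
      exists s => //; apply: le_trans ((svalP s).1.1 _ _) _.
      by rewrite lerD2l.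
    + by move=> s t x As t0; exists s => //; rewrite (svalP s).1.2// ltW.
  have qle s x : A s -> inf [set sval s x | s in A] <= sval s x.
    move=> As; apply: ge_inf; last by exists s.
    by have [m mP] := glb x; exists m => _ [j Aj <-]; exact: mP.
  have qp x : inf [set sval s x | s in A] <= p x.
    exact: le_trans (qle s0 x As0) ((svalP s0).2 x).
  exists (exist sub_p _ (conj sq qp)) => s As.
  by apply/asboolP => x; exact: qle.
exists q; split=> // q' sq' q'q.
have q'p x : q' x <= p x by exact: le_trans (q'q x) (qp x).
by have /(congr1 sval) := qmin (exist sub_p q' (conj sq' q'p)) (asboolT q'q).
Qed.

(* A minimal [q] equals [y |-> inf_t q (y + t x) - t q x], so that
   [q y + q x <= q (y + x)]. *)
Lemma hahn_banach (R : realType) (V : lmodType R) (p : V -> R) :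
  sublinear p -> exists phi : {linear V -> R^o}, forall x, phi x <= p x.
Proof.
move=> /minimal_sublinear[q [sq qp qmin]].
have qD x y : q (x + y) = q x + q y.
  apply/eqP; rewrite eq_le sq.1/=.
  pose g (t : R) z := q (z + t *: y) - t * q y.
  have glb z : exists m, forall t, 0 <= t -> m <= g t z.
    exists (- q (- z)) => t t0; rewrite /g lerBrDl lerBlDr -sq.2//.
    by apply: le_trans (sq.1 _ _); rewrite addrAC subrr add0r.
  have sg : sublinear (fun z => inf [set g t z | t in [set t | 0 <= t]]).
    apply: sublinear_inf => //.
    - by exists 0 => //=; rewrite /g add0r sq.2// subrr.
    - by move=> t t0; rewrite /g add0r sq.2// subrr.
    - move=> t u z w /= t0 u0; exists (t + u); first exact: addr_ge0.
      rewrite /g scalerDl mulrDl opprD addrACA [leRHS]addrACA lerD2r.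
      exact: sq.1.
    - move=> t u z /= t0 u0; exists (u * t); first by rewrite mulr_ge0// ltW.
      by rewrite /g -scalerA -scalerDr (sq.2 _ _ (ltW u0)) mulrBr mulrA.
  have gle t z : 0 <= t -> inf [set g t z | t in [set t | 0 <= t]] <= g t z.
    move=> t0; apply: ge_inf; last by exists t.
    by have [m mP] := glb z; exists m => _ [j Aj <-]; exact: mP.
  have gq : (fun z => inf [set g t z | t in [set t | 0 <= t]]) = q.
    apply: (qmin _ sg) => z; apply: le_trans (gle 0 z (lexx _)) _.
    by rewrite /g scale0r addr0 mul0r subr0.
  have := gle 1 x ler01; rewrite (congr1 (@^~ x) gq : inf _ = q x) /g.
  by rewrite scale1r mul1r lerBrDr.
have qN x : q (- x) = - q x.
  by apply/eqP; rewrite -addr_eq0 -qD addNr (sublinear0 sq).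
have qZ t x : q (t *: x) = t * q x.
  have [t0|/ltW t0] := lerP 0 t; first exact: sq.2.
  by rewrite -[in LHS](opprK t) scaleNr qN sq.2 ?oppr_ge0// mulNr opprK.
have qlin : linear (q : V -> R^o) by move=> t x y; rewrite qD qZ.
pose Q := GRing.isLinear.Build R V R^o *:%R q qlin.
pose phi : {linear V -> R^o} := HB.pack (q : V -> R^o) Q.
by exists phi.
Qed.

Lemma bounded_functional_continuous (R : realType) (X : normedModType R)
    (phi : {linear X -> R^o}) :
  (forall x, `|phi x| <= `|x|) -> continuous phi.
Proof.
move=> phi_le; apply: bounded_linear_continuous; apply/linear_boundedP.
near=> r => x; apply: le_trans (phi_le x) _; rewrite ler_peMl//.

Unshelve. all: by end_near. Qed.

Notation is_convex C := (convex_set (C : set (convex_lmodType _))).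

Lemma convex_setP (R : realType) (V : lmodType R) (C : set V) :
  is_convex C <->
  forall t x y, 0 <= t <= 1 -> C x -> C y -> C (t *: x + (1 - t) *: y).
Proof.
split=> [cvxC t x y /andP[t0 t1] Cx Cy|cvxC x y t].
  exact: set_mem (cvxC x y (Itv01 t0 t1) (mem_set Cx) (mem_set Cy)).
move=> /set_mem Cx /set_mem Cy; apply/mem_set/cvxC => //.
by rewrite ge0 le1.
Qed.

(** Hahn-Banach is applied to the infimum of [|x + t (c - b)| - t d] over [t >= 0] and [c] in [C].
    Taking [t = 0] bounds it by the norm; taking [t = 1] and [x = - (c - b)] bounds it by [- d]
    there. *)
Lemma hahn_banach_separation (R : realType) (X : normedModType R) (C : set X)
    (b : X) (d : R) :
  is_convex C -> C !=set0 -> (forall c, C c -> d <= `|c - b|) ->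
  exists phi : {linear X -> R^o},
    (forall x, `|phi x| <= `|x|) /\ (forall c, C c -> d <= phi (c - b)).
Proof.
move=> /convex_setP cvxC [c0 Cc0] dC.
pose A : set (R * X) := [set i | 0 <= i.1 /\ C i.2].
pose g (i : R * X) x := `|x + i.1 *: (i.2 - b)| - i.1 * d.
have glb i x : A i -> - `|x| <= g i x.
  move=> [/= t0 Ci]; rewrite /g lerBrDl lerBlDr.
  have : i.1 * d <= `|i.1 *: (i.2 - b)|.
    by rewrite normrZ ger0_norm// ler_wpM2l// dC.
  move=> /le_trans; apply; rewrite -(normrN x).
  by apply: le_trans (ler_normD _ _); rewrite addrAC subrr add0r.
have gub x i : A i -> inf [set g i x | i in A] <= g i x.
  move=> Ai; apply: ge_inf; last by exists i.
  by exists (- `|x|) => _ [j Aj <-]; exact: glb.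
have [|phi phi_le] := @hahn_banach _ _ (fun x => inf [set g i x | i in A]).
  apply: sublinear_inf.
  - exists (0, c0); first by split => /=.
    by rewrite /g /= scale0r addr0 normr0 mul0r subr0.
  - by move=> x; exists (- `|x|) => i; exact: glb.
  - by move=> i Ai; have := glb i 0 Ai; rewrite normr0 oppr0.
  - move=> [t c] [u c'] x y [/= t0 Cc] [/= u0 Cc'].
    (* With [t = u = 0] the weights below are undefined, but only the triangle inequality
       remains. *)
    have [tu0|tu0] := eqVneq (t + u) 0.
      have t00 : t = 0 by lra.
      have u00 : u = 0 by lra.
      exists (0, c); first by split => /=.
      rewrite /g /= t00 u00 !scale0r !addr0 !mul0r !subr0.
      exact: ler_normD.
    have tu_gt0 : 0 < t + u by rewrite lt_neqAle eq_sym tu0 addr_ge0.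
    (* The weighted mean [c''] of [c] and [c'] for which [(t + u) (c'' - b) = t (c - b) + u (c' -
       b)]. *)
    exists (t + u, (t / (t + u)) *: c + (1 - t / (t + u)) *: c').
      split => /=; first exact: ltW.
      apply: cvxC => //; rewrite divr_ge0 ?(ltW tu_gt0)//=.
      by rewrite ler_pdivrMr// mul1r lerDl.
    rewrite /g /= mulrDl opprD addrACA lerD2r.
    apply: le_trans (ler_normD _ _).
    rewrite le_eqVlt; apply/predU1P; left.
    congr (`| _ |); rewrite addrACA; congr (_ + _).
    rewrite !scalerBr !scalerDr !scalerA.
    have -> : (t + u) * (t / (t + u)) = t by field.
    have -> : (t + u) * (1 - t / (t + u)) = u by field.
    by rewrite scalerDl opprD addrACA.
  - move=> [t c] u x [/= t0 Cc] u0; exists (u * t, c).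
      by split => //=; rewrite mulr_ge0// ltW.
    rewrite /g /= -scalerA -scalerDr normrZ gtr0_norm//.
    by rewrite mulrBr mulrA.
have phi_norm x : phi x <= `|x|.
  apply: le_trans (phi_le x) _; apply: le_trans (gub x (0, c0) _) _ => //=.
  by rewrite /g /= scale0r addr0 mul0r subr0.
exists phi; split=> [x|c Cc].
  rewrite ler_norml phi_norm andbT lerNl -[- phi x]linearN.
  by rewrite -(normrN x); exact: phi_norm.
have := le_trans (phi_le (- (c - b))) (gub _ (1, c) (conj ler01 Cc)).
rewrite linearN /g /= scale1r addNr normr0 mul1r sub0r.
by rewrite lerN2.
Qed.

(** Separation of the singleton [x] from the origin, at distance [|x|]. *)
Lemma norming_functional (R : realType) (X : normedModType R) (x : X) :
  exists phi : {linear X -> R^o},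
    (forall y, `|phi y| <= `|y|) /\ `|x| <= phi x.
Proof.
have [||c ->|phi [phi1 phix]] :=
    @hahn_banach_separation R X [set x] 0 `|x|.
- by apply/convex_setP => t _ _ _ -> ->; rewrite -scalerDl addrC subrK scale1r.
- by exists x.
- by rewrite subr0.
by exists phi; split => //; have := phix x erefl; rewrite subr0.
Qed.

(** The hypothesis puts [b] in every closed half-space containing [C]. If [C] kept distance [e] from
    [b], a separating functional would give [phi b + e <= phi c] on [C], hence
    [phi b + e <= phi b]. *)
Lemma mazur (R : realType) (X : normedModType R) (C : set X) (b : X) :
  is_convex C -> C !=set0 ->
  (forall phi : {linear X -> R^o}, continuous phi ->
     forall a, (forall x, C x -> a <= phi x) -> a <= phi b) ->
  forall e, 0 < e -> exists2 x, C x & `|x - b| < e.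
Proof.
move=> cvxC C0 Cb e e0; apply: contrapT => noC.
have [|phi [phi1 phiC]] := @hahn_banach_separation R X C b e cvxC C0.
  by move=> c Cc; rewrite leNgt; apply/negP => ce; apply: noC; exists c.
have := Cb phi (bounded_functional_continuous phi1) (phi b + e).
rewrite -subr_ge0 opprD addrA subrr add0r oppr_ge0 leNgt e0 => H.
suff: false by []; apply: H => x /phiC.
by rewrite linearB lerBrDl.
Qed.

(** * Weak sequential compactness *)

Lemma exists_subseq (P : nat -> nat -> Prop) :
  (forall m N, exists2 n, (N <= n)%N & P m n) ->
  exists k : nat -> nat, {homo k : m n / (m < n)%N} /\ forall m, P m (k m).
Proof.
move=> HP.
have /choice[g gP] (p : nat * nat) : exists n, (p.2 <= n)%N /\ P p.1 n.
  by have [n] := HP p.1 p.2; exists n.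
(* Searching from [(k m').+1] on makes [k] strictly increasing. *)
pose k := fix k m := g (m, if m is m'.+1 then (k m').+1 else 0%N).
exists k; split; last first.
  by case=> [|m]; [have [] := gP (0, 0)%N|have [] := gP (m.+1, (k m).+1)].
apply: homo_ltn => [|m]; first exact: ltn_trans.
by have [] := gP (m.+1, (k m).+1).
Qed.

Lemma homo_ltn_geq (k : nat -> nat) (n : nat) :
  {homo k : m n / (m < n)%N} -> (n <= k n)%N.
Proof.
move=> k_mono; elim: n => // n IHn.
exact: leq_ltn_trans IHn (k_mono n n.+1 (ltnSn n)).
Qed.

(** Compactness of [[- M, M]] gives a cluster point, and an ultrafilter converges to each of its
    cluster points. *)
Lemma ultra_cvg_bounded (R : realType) (T : Type) (U : set_system T)
    (u : T -> R) (M : R) :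
  UltraFilter U -> (forall t, `|u t| <= M) ->
  exists l : R, u x @[x --> U] --> l.
Proof.
move=> UU uM.
have [|l [_ cl]] := @segment_compact R (- M) M (fmap u U) _.
  by apply: (@filterS _ U) filterT => // t _ /=; rewrite in_itv/= -ler_norml.
exists l => B lB; have [//|UnB] := in_ultra_setVsetC (u @^-1` B) UU.
by have [x []] := cl (~` B) B UnB lB.
Qed.

(** In place of a diagonal argument: stage [m] asks the indices with code below [m] to be within
    [1 / (m + 1)] of their limits. This set of [n] belongs to [U], so it meets every tail. Codes
    that decode to no index impose nothing. *)
Lemma ultra_cvg_subseq (R : realType) (T : countType) (U : set_system nat)
    (u : T -> nat -> R) (l : T -> R) :
  UltraFilter U -> \oo `<=` U -> (forall i, u i n @[n --> U] --> l i) ->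
  exists k : nat -> nat, {homo k : m n / (m < n)%N} /\
    forall i, (u i \o k) @ \oo --> l i.
Proof.
move=> UU ooU ul.
pose P m n := forall j : 'I_m,
  if unpickle j is Some i then `|l i - u i n| < m.+1%:R^-1 else true.
have UP m : U [set n | P m n].
  apply: filter_forall => j; case: (unpickle j) => [i|]; last exact: filterE.
  by have /cvgrPdist_lt := ul i; apply; rewrite invr_gt0.
have [|k [k_mono Pk]] := @exists_subseq P.
  move=> m N.
  have UN : U [set n | (N <= n)%N] by apply: ooU; exists N.
  by have [n [Pn Nn]] := filter_ex (filterI (UP m) UN); exists n.
exists k; split=> // i; apply/cvgrPdist_lt => e e0.
near=> m.
have im : (pickle i < m)%N by near: m; exists (pickle i).+1.
have := Pk m (Ordinal im); rewrite /= pickleK => /lt_le_trans; apply.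
by near: m; apply: filterS (near_infty_natSinv_lt (PosNum e0)) => m /ltW.
Unshelve. all: by end_near. Qed.

(* [b] lies in every closed half-space containing a tail of [z]; weak limits
   and weak cluster points of [z] are such points, and so are weak limits of
   convex combinations of its tails. *)
Definition tail_point (R : realType) (X : normedModType R) (z : nat -> X)
    (b : X) : Prop :=
  forall phi : {linear X -> R^o}, continuous phi ->
  forall a N, (forall n, (N <= n)%N -> a <= phi (z n)) -> a <= phi b.

(** The half-spaces [l - e <= phi] and [- l - e <= - phi] both contain a tail of [z], hence also
    [b]. *)
Lemma tail_point_cvg (R : realType) (X : normedModType R) (z : nat -> X)
    (b : X) (phi : {linear X -> R^o}) (l : R) :
  tail_point z b -> continuous phi -> (fun n => phi (z n) : R) @ \oo --> l ->
  phi b = l.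
Proof.
move=> zb cphi /cvgrPdist_le zl.
have low : l <= phi b.
  apply/ler_addgt0Pr => e e0; rewrite -lerBlDr.
  have [N _ NP] := zl e e0; apply: (zb phi cphi _ N) => n /NP/=.
  by rewrite ler_norml lerBlDr -lerBlDl lerBlDr => /andP[_]; rewrite addrC.
have upp : - l <= - phi b.
  apply/ler_addgt0Pr => e e0; rewrite -lerBlDr.
  have cN : continuous (\- phi : X -> R^o).
    by move=> x; apply: cvgN; exact: cphi.
  have [N _ NP] := zl e e0; apply: (zb (\- phi) cN _ N) => n /NP/=.
  by rewrite ler_norml => /andP[+ _]; lra.
by apply/eqP; rewrite eq_le low -lerN2 upp.
Qed.

Lemma weakly_cvg_tail_point (R : realType) (X : normedModType R)
    (z : nat -> X) (b : X) :
  weakly_cvg_to z b -> tail_point z b.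
Proof.
move=> zb phi cphi a N aN; have /cvgrPdist_le zl := zb phi cphi.
apply/ler_addgt0Pr => e e0; have [m _ mP] := zl e e0.
have := mP (maxn N m) (leq_maxr _ _); have := aN (maxn N m) (leq_maxl _ _).
by rewrite /= ler_norml => ? /andP[? _]; lra.
Qed.

(** Closed convex sets are weakly closed: Mazur's theorem puts [b] in the closure of [C]. *)
Lemma tail_point_mem (R : realType) (X : normedModType R) (C : set X)
    (z : nat -> X) (b : X) :
  is_convex C -> closed C -> (forall n, C (z n)) -> tail_point z b -> C b.
Proof.
move=> cvxC clC Cz zb; apply: clC => B /nbhs_ballP[e /= e0 eB].
have [||x Cx xb] := @mazur _ _ C b cvxC _ _ e e0; first by exists (z 0%N).
  by move=> phi cphi a aC; apply: (zb phi cphi a 0%N) => n _; exact: aC.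
by exists x; split => //; apply: eB; rewrite -ball_normE/= distrC.
Qed.

(** * The closed linear span of a sequence *)

Section rational_span.
Variables (R : realType) (X : normedModType R) (z : nat -> X).

(** Rational coefficients keep the index type countable, so [ultra_cvg_subseq] handles the norming
    functionals of all combinations at once. *)
Definition qcomb (s : seq (rat * nat)) : X :=
  \sum_(p <- s) (ratr p.1 : R) *: z p.2.

(** The closed real linear span of [z], as the closure of its rational combinations. *)
Definition qspan : set X :=
  [set x | forall e, 0 < e -> exists s, `|x - qcomb s| < e].

Lemma qspanD x y : qspan x -> qspan y -> qspan (x + y).
Proof.
move=> qx qy e e0; have e2 : 0 < e / 2 by rewrite divr_gt0.
have [s xs] := qx _ e2; have [t yt] := qy _ e2.
exists (s ++ t); rewrite /qcomb big_cat/= -/(qcomb s) -/(qcomb t).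
rewrite opprD addrACA; apply: le_lt_trans (ler_normD _ _) _.
by rewrite [ltRHS](splitr e) ltrD.
Qed.

(** With [s] close to [x] and a rational [q] close to [a], both terms of [a (x - s) + (a - q) s] are
    small. Each [+ 1] keeps a denominator positive. *)
Lemma qspanZ a x : qspan x -> qspan (a *: x).
Proof.
move=> qx e e0.
have [s xs] : exists s, `|x - qcomb s| < e / 2 / (`|a| + 1).
  by apply: qx; rewrite !divr_gt0// ltr_wpDl.
have [q aq] : exists q : rat, `|a - ratr q| < e / 2 / (`|qcomb s| + 1).
  set d := _ / (_ + 1); have d0 : 0 < d by rewrite !divr_gt0// ltr_wpDl.
  have ltd : a - d < a + d by lra.
  have [q] := rat_in_itvoo ltd; rewrite in_itv/= => /andP[aq qa].
  by exists q; rewrite ltr_norml; apply/andP; split; lra.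
exists [seq (q * p.1, p.2) | p <- s].
rewrite /qcomb big_map/=.
under eq_bigr do rewrite rmorphM/= -scalerA.
rewrite -scaler_sumr -/(qcomb s).
have -> : a *: x - ratr q *: qcomb s =
    a *: (x - qcomb s) + (a - ratr q) *: qcomb s.
  by rewrite scalerBr scalerBl addrA subrK.
apply: le_lt_trans (ler_normD _ _) _; rewrite [ltRHS](splitr e) !normrZ.
apply: ltr_leD.
  apply: (@le_lt_trans _ _ ((`|a| + 1) * `|x - qcomb s|)).
    by rewrite ler_wpM2r// lerDl.
  by rewrite -ltr_pdivlMl ?ltr_wpDl// mulrC.
apply: (@le_trans _ _ (`|a - ratr q| * (`|qcomb s| + 1))).
  by rewrite ler_wpM2l// lerDl.
by rewrite -ler_pdivlMr ?ltr_wpDl// ltW.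
Qed.

Lemma qspan_closed : closed qspan.
Proof.
move=> x clx e e0; have e2 : 0 < e / 2 by rewrite divr_gt0.
have [y [qy xy]] := clx _ (nbhsx_ballx x _ e2).
have [s ys] := qy _ e2; exists s.
rewrite -(subrK y x) -addrA; apply: le_lt_trans (ler_normD _ _) _.
rewrite [ltRHS](splitr e) ltrD//.
by move: xy; rewrite -ball_normE.
Qed.

Lemma qspan_convex : is_convex qspan.
Proof.
by apply/convex_setP => t x y _ qx qy; apply: qspanD; exact: qspanZ.
Qed.

Lemma qspan_mem n : qspan (z n).
Proof.
move=> e e0; exists [:: (1, n)].
by rewrite /qcomb big_seq1/= rmorph1 scale1r subrr normr0.
Qed.

(** If [s] is a combination within [e / 2] of [x], then [|s| <= f_s s = f_s (s - x) <= |s - x|], so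
    [|x| <= e]. *)
Lemma qspan_separated (f : seq (rat * nat) -> {linear X -> R^o}) x :
  (forall s y, `|f s y| <= `|y|) -> (forall s, `|qcomb s| <= f s (qcomb s)) ->
  qspan x -> (forall s, f s x = 0) -> x = 0.
Proof.
move=> f1 fs qx fx; apply/eqP; rewrite -normr_le0.
apply/ler_addgt0Pr => e e0; rewrite add0r.
have [s xs] : exists s, `|x - qcomb s| < e / 2 by apply: qx; rewrite divr_gt0.
have qs : `|qcomb s| <= e / 2.
  apply: le_trans (fs s) _; rewrite -[leLHS]subr0 -(fx s) -linearB.
  apply: le_trans (ler_norm _) _; apply: le_trans (f1 _ _) _.
  by rewrite distrC ltW.
rewrite -(subrK (qcomb s) x); apply: le_trans (ler_normD _ _) _.
by rewrite [leRHS](splitr e) lerD// ltW.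
Qed.

End rational_span.

(* Along a subsequence the norming functionals of the countable set of
   [qcomb z s] all converge, so they take the same values at the tail points of
   all further subsequences; since they separate the points of [qspan z], there
   is a single such tail point, and it is the weak limit. *)
Lemma bounded_tail_points_weakly_cvg (R : realType) (X : normedModType R)
    (z : nat -> X) (M : R) :
  (forall n, `|z n| <= M) ->
  (forall k : nat -> nat, {homo k : m n / (m < n)%N} ->
     exists b, tail_point (z \o k) b) ->
  has_weakly_cvg_subseq z.
Proof.
move=> zM ztp.
have [U [UU ooU]] := ultraFilterLemma (@eventually_filter).
have /choice[f fP] s := @norming_functional R X (qcomb z s).
have f1 s := (fP s).1; have fs s := (fP s).2.
have fcont s := bounded_functional_continuous (f1 s).
have /choice[l lP] s : exists l : R, (f s (z n) : R) @[n --> U] --> l.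
  apply: (@ultra_cvg_bounded _ _ _ _ M) => n.
  exact: le_trans (f1 s _) (zM n).
have [k [k_mono kl]] := ultra_cvg_subseq UU ooU lP.
have [b zb] := ztp k k_mono.
exists k, b; split => //.
(* A one-sided bound suffices, as it also applies to [- phi]. If it fails, a further subsequence
   stays in [phi b + e <= phi]; its tail point [b'] lies there too, although [b' = b]. *)
have upper (phi : {linear X -> R^o}) e : continuous phi -> 0 < e ->
    \forall n \near \oo, phi (z (k n)) < phi b + e.
  move=> cphi e0; apply: contrapT => freq.
  have [|k' [k'_mono k'P]] :=
      @exists_subseq (fun _ n => phi b + e <= phi (z (k n))).
    move=> _ N; apply: contrapT => noN; apply: freq; exists N => // n /= Nn.
    by rewrite ltNge; apply/negP => ?; apply: noN; exists n.
  have [|b' zb'] := ztp (k \o k'); first by move=> m n /k'_mono/k_mono.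
  have bb' : b - b' = 0.
    apply: (@qspan_separated _ _ z f) => //.
      rewrite -scaleN1r; apply: qspanD; [|apply: qspanZ].
        apply: tail_point_mem zb; [exact: qspan_convex|exact: qspan_closed|].
        by move=> n; exact: qspan_mem.
      apply: tail_point_mem zb'; [exact: qspan_convex|exact: qspan_closed|].
      by move=> n; exact: qspan_mem.
    move=> s; rewrite linearB (tail_point_cvg zb (fcont s) (kl s)).
    rewrite (tail_point_cvg zb' (fcont s) (_ : _ --> l s)) ?subrr//.
    apply: (cvg_comp _ _ _ (kl s)) => A [N _ NA]; exists N => // n /= Nn.
    by apply: NA => /=; exact: leq_trans Nn (homo_ltn_geq _ k'_mono).
  have : phi b + e <= phi b'.
    by apply: (zb' phi cphi _ 0%N) => n _; exact: k'P.
  by rewrite (subr0_eq bb') -subr_ge0 opprD addrA subrr add0r oppr_ge0 leNgt e0.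
move=> phi cphi; apply/cvgrPdist_lt => e e0.
have cN : continuous (\- phi : X -> R^o).
    by move=> x; apply: cvgN; exact: cphi.
near=> n; rewrite ltr_norml /=.
have h1 : phi (z (k n)) < phi b + e by near: n; exact: upper.
have h2 : - phi (z (k n)) < - phi b + e by near: n; exact: (upper (\- phi)).
by apply/andP; split; lra.
Unshelve. all: by end_near. Qed.

(** * Subspaces *)

Lemma homo_ltn_cvg (k : nat -> nat) :
  {homo k : m n / (m < n)%N} -> k n @[n --> \oo] --> \oo.
Proof.
move=> k_mono A [N _ NA]; exists N => // n /= Nn.
by apply: NA => /=; exact: leq_trans Nn (homo_ltn_geq _ k_mono).
Qed.

Section subspaces.
Variables (R : realType) (X : normedModType R) (Y : set X).
Hypothesis Ysub : closed_subspace Y.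

Lemma subspace0 : Y 0.
Proof. by have [[+ _] _] := Ysub; rewrite inE. Qed.

Lemma subspace_lin a u v : Y u -> Y v -> Y (a *: u + v).
Proof.
move=> Yu Yv; have [[_ lin] _] := Ysub.
by have := lin a u v; rewrite !inE; apply.
Qed.

Lemma subspaceD u v : Y u -> Y v -> Y (u + v).
Proof. by move=> Yu Yv; rewrite -[u]scale1r; exact: subspace_lin. Qed.

Lemma subspaceZ a u : Y u -> Y (a *: u).
Proof. by move=> Yu; rewrite -[_ *: _]addr0; exact: subspace_lin subspace0. Qed.

Lemma subspaceB u v : Y u -> Y v -> Y (u - v).
Proof. by move=> Yu Yv; rewrite addrC -scaleN1r; exact: subspace_lin. Qed.

Lemma subspace_convex : is_convex Y.
Proof.
by apply/convex_setP => t x y _ Yx Yy; apply: subspaceD; exact: subspaceZ.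
Qed.

Lemma linear_on0 f : linear_on Y f -> f 0 = 0.
Proof.
move=> /(_ 1 _ _ subspace0 subspace0); rewrite scale1r addr0 mul1r => f0.
by apply: (@addrI _ (f 0)); rewrite -f0 addr0.
Qed.

Lemma le_dual_norm f y : dual Y f -> Y y -> `|f y| <= `|y| * dual_norm Y f.
Proof.
move=> [flin [C fC]] Yy; have f0 := linear_on0 flin.
have [->|y0] := eqVneq y 0; first by rewrite f0 !normr0 mul0r.
have ny : 0 < `|y| by rewrite normr_gt0.
have Yu : Y (`|y|^-1 *: y) by exact: subspaceZ.
have nu : `| `|y|^-1 *: y| = 1.
  by rewrite normrZ normfV normr_id mulVf ?gt_eqF.
have : `|f (`|y|^-1 *: y)| <= dual_norm Y f.
  apply: ub_le_sup; last first.
    by exists (`|y|^-1 *: y) => //; split=> //=; rewrite nu.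
  exists `|C| => _ [x [Yx /= x1] <-]; apply: le_trans (fC x Yx) _.
  apply: le_trans (ler_norm _) _; rewrite normrM normr_id.
  by rewrite ler_piMr.
have := flin `|y|^-1 y 0 Yy subspace0; rewrite f0 !addr0 => ->.
by rewrite normrM normfV normr_id ler_pdivrMl.
Qed.

Lemma continuous_dual (phi : {linear X -> R^o}) : continuous phi -> dual Y phi.
Proof.
move=> /linear_bounded_continuous /linear_boundedP [r [_ rP]]; split.
  by move=> a u v _ _; rewrite linearP.
by exists (r + 1) => y _; apply: rP; rewrite ltrDl.
Qed.

(** Limits of [f (y n)] along an ultrafilter [U] finer than [\oo] define an element of the bidual,
    which reflexivity represents by a point [b]. Since [U] contains all tails, [b] is a tail
    point. *)
Lemma reflexive_tail_point (y : nat -> X) (M : R) : reflexive_subspace Y ->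
  (forall n, Y (y n)) -> (forall n, `|y n| <= M) -> exists b, tail_point y b.
Proof.
move=> Yrefl Yy yM.
have [U [UU ooU]] := ultraFilterLemma (@eventually_filter).
have M0 : 0 <= M by exact: le_trans (yM 0%N).
have fcvg f : dual Y f -> cvg (f (y n) @[n --> U]).
  move=> [_ [C fC]].
  have [|l fl] := @ultra_cvg_bounded R nat U (f \o y) (`|C| * M) UU.
    move=> n /=; apply: le_trans (fC _ (Yy n)) _.
    apply: le_trans (ler_norm _) _; rewrite normrM normr_id.
    by rewrite ler_wpM2l.
  by apply/cvg_ex; exists l.
pose Phi f : R := lim (f (y n) @[n --> U]).
have [|b Yb Phib] := Yrefl Phi.
  split.
    move=> a f g df dg; apply: cvg_lim => //.
    by apply: cvgD; [apply: cvgMr; exact: fcvg|exact: fcvg].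
  exists M => f df; rewrite /Phi.
  have le_f n : `|f (y n)| <= M * dual_norm Y f.
    apply: le_trans (le_dual_norm df (Yy n)) _; rewrite ler_wpM2r//.
    apply: ub_le_sup; last first.
      exists 0; first by split; [exact: subspace0|rewrite /= normr0].
      by have [flin _] := df; rewrite (linear_on0 flin) normr0.
    have [_ [C fC]] := df.
    exists `|C| => _ [x [Yx /= x1] <-]; apply: le_trans (fC x Yx) _.
    apply: le_trans (ler_norm _) _; rewrite normrM normr_id.
    by rewrite ler_piMr.
  rewrite ler_norml; apply/andP; split.
    apply: limr_ge; first exact: fcvg.
    by apply: filterE => n; have := le_f n; rewrite ler_norml => /andP[].
  apply: limr_le; first exact: fcvg.
  by apply: filterE => n; have := le_f n; rewrite ler_norml => /andP[].
exists b => phi /continuous_dual dphi a N aN; rewrite -(Phib _ dphi).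
apply: limr_ge; first exact: fcvg.
by apply: ooU; exists N => // n /= /aN.
Qed.

End subspaces.

(** * Bounded decompositions in a closed sum of subspaces *)

Section bounded_decomposition.
Variables (R : realType) (X : completeNormedModType R).

(** Increments telescope to [|w m - w n| <= r n - r m <= r n] for [n <= m]. This covers nested balls
    of radii [r n] as well as geometric series with remainders [r n]. *)
Lemma telescoping_cvg (w : nat -> X) (r : nat -> R) :
  (forall n, 0 <= r n) -> r n @[n --> \oo] --> 0 ->
  (forall n, `|w n.+1 - w n| <= r n - r n.+1) ->
  exists2 l, w n @[n --> \oo] --> l & forall n, `|l - w n| <= r n.
Proof.
move=> r0 rcvg wr.
have wD n m : `|w (n + m)%N - w n| <= r n - r (n + m)%N.
  elim: m => [|m IHm]; first by rewrite addn0 !subrr normr0.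
  rewrite addnS -[w _](subrK (w (n + m)%N)) -addrA.
  apply: le_trans (ler_normD _ _) _; have := wr (n + m)%N; lra.
have wle n m : (n <= m)%N -> `|w m - w n| <= r n.
  move=> /subnKC <-; apply: le_trans (wD _ _) _.
  by rewrite gerBl.
have /cvg_ex[l wl] : cvg (w n @[n --> \oo]).
  apply/cauchy_cvgP/cauchy_exP => e e0.
  have /cvgrPdist_lt/(_ e e0)[N _ NP] := rcvg.
  exists (w N); exists N => // n /= Nn.
  rewrite -ball_normE /= distrC; apply: le_lt_trans (wle _ _ Nn) _.
  by have := NP N (leqnn _); rewrite /= sub0r normrN ger0_norm.
exists l => // n.
apply: (@closed_cvg _ _ \oo _ (fun m => w m) [set x | `|x - w n| <= r n]) => //.
  apply: (@closed_comp _ _ (fun x => `|x - w n|) [set x | x <= r n]).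
    move=> x _; apply: cvg_norm; apply: cvgB; [exact: cvg_id|exact: cvg_cst].
  exact: closed_le.
by exists n => // m /= nm; exact: wle.
Qed.

Variables (Y Z : set X).
Hypotheses (Ysub : closed_subspace Y) (Zsub : closed_subspace Z).
Let W := set_sum Y Z.
Hypothesis Wclosed : closed W.

Let W_lin a u v : W u -> W v -> W (a *: u + v).
Proof.
move=> [y Yy [z Zz <-]] [y' Yy' [z' Zz' <-]].
exists (a *: y + y'); first exact: subspace_lin.
exists (a *: z + z'); first exact: subspace_lin.
by rewrite scalerDr addrACA.
Qed.

(** These sets exhaust [W]. Only the [Y] summand is bounded; a bound on the other one follows by
    subtraction. *)
Let B (n : nat) : set X :=
  [set v | exists y z, [/\ Y y, Z z, v = y + z & `|y| <= n%:R]].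

(* Baire's argument in [W]: otherwise nested balls of [W] shrink to a point
   of [W] avoiding every [B n]. *)
Let B_somewhere_dense : exists n w0 r, [/\ 0 < r, W w0 &
  forall w, W w -> `|w - w0| < r -> forall e, 0 < e ->
    exists2 b, B n b & `|w - b| < e].
Proof.
apply: contrapT => nodense.
(* Every ball of [W] contains one of at most half the radius that misses [B n]. The implications
   make the statement total in [p], as [choice] requires. *)
have hole (p : nat * (X * R)) : exists q : X * R,
    W p.2.1 -> 0 < p.2.2 ->
    [/\ W q.1, 0 < q.2, `|q.1 - p.2.1| <= p.2.2 - q.2, q.2 <= p.2.2 / 2 &
        forall b, B p.1 b -> q.2 < `|q.1 - b|].
  case: p => n [w0 r] /=.
  have [Ww0|?] := pselect (W w0); last by exists (w0, r).
  have [r0|?] := pselect (0 < r); last by exists (w0, r).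
  have r20 : 0 < r / 2 by rewrite divr_gt0.
  apply: contrapT => noq; apply: nodense; exists n, w0, (r / 2); split => //.
  move=> w Ww ww0 e e0; apply: contrapT => nob; apply: noq.
  (* [e / 2] makes the new closed ball miss [B n], which is at distance at least [e]; [r / 2] keeps
     it inside the old one. *)
  exists (w, Num.min (e / 2) (r / 2)) => _ _ /=.
  have le1 : Num.min (e / 2) (r / 2) <= e / 2 by rewrite ge_min lexx.
  have le2 : Num.min (e / 2) (r / 2) <= r / 2 by rewrite ge_min lexx orbT.
  split => //.
  - by rewrite lt_min r20 divr_gt0.
  - by lra.
  - move=> b Bb; have : e <= `|w - b|.
      by rewrite leNgt; apply/negP => wb; apply: nob; exists b.
    by lra.
have /choice[h hP] := hole.
pose s := fix s n := if n is m.+1 then h (m, s m) else (0 : X, 1 : R).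
have W0 : W 0.
  by exists 0; [exact: subspace0|exists 0; [exact: subspace0|rewrite addr0]].
have sP n : W (s n).1 /\ 0 < (s n).2.
  elim: n => [|n [Wn rn]] //=.
  by have [] := hP (n, s n) Wn rn.
have step n := hP (n, s n) (sP n).1 (sP n).2.
have rle n : (s n).2 <= geometric 1 (2^-1) n.
  elim: n => [|n IHn]; first by rewrite /= expr0 mulr1.
  have [_ _ _ + _] := step n; move=> /le_trans; apply.
  by move: IHn; rewrite /= exprSr !mul1r; lra.
have [|||l sl lr] := @telescoping_cvg (fun n => (s n).1) (fun n => (s n).2).
- by move=> n; exact: ltW (sP n).2.
- apply: (@squeeze_cvgr _ _ _ _ (cst 0) (geometric 1 (2^-1))).
  + by apply: filterE => n; rewrite rle ltW//; exact: (sP n).2.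
  + exact: cvg_cst.
  + by apply: cvg_geometric; rewrite ger0_norm//; lra.
- by move=> n; have [] := step n.
have Wl : W l.
  by apply: (closed_cvg W Wclosed _ _ sl); apply: filterE => n; exact: (sP n).1.
have [y Yy [z Zz yz]] := Wl.
(* The limit [l] lies in some [B n], but also in the ball of index [n + 1], chosen to avoid
   [B n]. *)
have Bl : B (Num.truncn `|y|).+1 l.
  by exists y, z; split => //; rewrite ltW// truncnS_gt.
have [_ _ _ _ /(_ l Bl)] := step (Num.truncn `|y|).+1.
rewrite distrC => /lt_le_trans /(_ (lr (Num.truncn `|y|).+2)).
by rewrite ltxx.
Qed.

(** Scale [w] by [s] to norm [r / 2], approximate [s w + w0] and [w0] within [r / 8] by points of
    [B n], and subtract: the error is [r / 4], half the norm of [s w]. Scaling back turns [2 n] into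
    [2 n / s = (4 n / r) |w|]. *)
Let approx : exists2 C, 0 <= C & forall w, W w ->
  exists p : X * X, [/\ Y p.1, Z p.2, `|p.1| <= C * `|w| &
    `|w - (p.1 + p.2)| <= `|w| / 2].
Proof.
have [n [w0 [r [r0 Ww0 dense]]]] := B_somewhere_dense.
exists (4 * n%:R / r); first by rewrite !mulr_ge0// invr_ge0 ltW.
move=> w Ww; have [->|w_neq0] := eqVneq w 0.
  exists (0, 0); rewrite /= addr0 subrr normr0 mulr0 mul0r.
  by split=> //; exact: subspace0.
have nw : 0 < `|w| by rewrite normr_gt0.
pose s := r / (2 * `|w|).
have s0 : 0 < s by rewrite divr_gt0// mulr_gt0.
have r8 : 0 < r / 8 by rewrite divr_gt0.
have nsw : `|s *: w| = r / 2.
  by rewrite normrZ gtr0_norm// /s; field; rewrite gt_eqF.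
have [||_ [y1 [z1 [Yy1 Zz1 -> y1n]]] b1] := dense (s *: w + w0) _ _ _ r8.
- exact: W_lin.
- by rewrite addrK nsw; lra.
have [|_ [y2 [z2 [Yy2 Zz2 -> y2n]]] b2] := dense w0 Ww0 _ _ r8.
  by rewrite subrr normr0.
exists (s^-1 *: (y1 - y2), s^-1 *: (z1 - z2)) => /=; split.
- by apply: subspaceZ => //; exact: subspaceB.
- by apply: subspaceZ => //; exact: subspaceB.
- rewrite normrZ gtr0_norm ?invr_gt0//.
  have -> : 4 * n%:R / r * `|w| = s^-1 * (n%:R + n%:R).
    by rewrite /s; field; rewrite !gt_eqF.
  rewrite ler_wpM2l ?invr_ge0 ?(ltW s0)//.
  by apply: le_trans (ler_normB _ _) _; exact: lerD.
have -> : w - (s^-1 *: (y1 - y2) + s^-1 *: (z1 - z2)) =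
    s^-1 *: ((s *: w + w0 - (y1 + z1)) - (w0 - (y2 + z2))).
  rewrite -scalerDr -[X in X - _ = _](scalerK (lt0r_neq0 s0)) -scalerBr.
  congr (_ *: _); rewrite (opprD w0) (addrACA (_ + _)) addrK.
  by rewrite -opprD (opprD y2) addrACA.
rewrite normrZ gtr0_norm ?invr_gt0// ler_pdivrMl//.
have -> : s * (`|w| / 2) = r / 4 by rewrite /s; field; rewrite gt_eqF.
by apply: le_trans (ler_normB _ _) _; lra.
Qed.

(** The open mapping argument: applying [approx] to successive remainders halves them each time, and
    the [Y] parts of the corrections sum to some [y] with [|y| <= 2 C |v|]. *)
Lemma bounded_decomposition : exists C, forall v, W v ->
  exists y z, [/\ Y y, Z z, v = y + z & `|y| <= C * `|v|].
Proof.
have [C C0 /= CP] := approx.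
have /choice[g gP] w : exists p : X * X, W w ->
    [/\ Y p.1, Z p.2, `|p.1| <= C * `|w| & `|w - (p.1 + p.2)| <= `|w| / 2].
  have [/CP[p pP]|nW] := pselect (W w); first by exists p.
  by exists (0, 0) => /nW.
exists (2 * C) => v Wv.
pose rem (p : X * X) := v - (p.1 + p.2).
pose s := fix s n := if n is m.+1 then s m + g (rem (s m)) else (0 : X * X).
have W_rem y z : Y y -> Z z -> W (v - (y + z)).
  move=> Yy Zz; rewrite addrC -scaleN1r; apply: W_lin => //.
  by exists y => //; exists z.
have rem_step n : rem (s n.+1) =
    rem (s n) - ((g (rem (s n))).1 + (g (rem (s n))).2).
  by rewrite {1}/rem /= addrACA opprD addrA.
have sYZ n : Y (s n).1 /\ Z (s n).2.
  elim: n => [|n [Yn Zn]] /=; first by split; exact: subspace0.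
  have [Yg Zg _ _] := gP _ (W_rem _ _ Yn Zn).
  by split; exact: subspaceD.
have gs n := gP (rem (s n)) (W_rem _ _ (sYZ n).1 (sYZ n).2).
have rem_le n : `|rem (s n)| <= geometric `|v| (2^-1) n.
  elim: n => [|n IHn]; first by rewrite /rem /= addr0 subr0 expr0 mulr1.
  have [_ _ _] := gs n; rewrite rem_step => /le_trans; apply.
  by move: IHn; rewrite /= exprSr; lra.
have half_lt1 : `|2^-1 : R| < 1 by rewrite ger0_norm//; lra.
(* Consecutive terms of this geometric sequence differ by [C |v| / 2^n], the bound on the [n]-th
   correction. *)
have [|||y sy yr] := @telescoping_cvg (fun n => (s n).1)
    (geometric (2 * C * `|v|) (2^-1)).
- by move=> n; rewrite /= mulr_ge0 ?exprn_ge0// !mulr_ge0.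
- exact: cvg_geometric.
- move=> n; rewrite /= addrAC subrr add0r.
  have [_ _ + _] := gs n; move=> /le_trans; apply.
  apply: (@le_trans _ _ (C * geometric `|v| (2^-1) n)).
    by rewrite ler_wpM2l.
  by rewrite /= exprSr; lra.
have Yy : Y y.
  apply: (closed_cvg Y Ysub.2 _ _ sy).
  by apply: filterE => n; exact: (sYZ n).1.
exists y, (v - y); split=> //.
(* [v - y] is the limit of [v - rem (s n) - (s n).1 = (s n).2], which lies in the closed set [Z]. *)
- have rem0 : rem (s n) @[n --> \oo] --> (0 : X).
    apply/norm_cvg0P.
    apply: (@squeeze_cvgr _ _ _ _ (cst 0) (geometric `|v| (2^-1))).
    + by apply: filterE => n; rewrite rem_le normr_ge0.
    + exact: cvg_cst.
    + exact: cvg_geometric.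
  have : (v - rem (s n) - (s n).1) @[n --> \oo] --> v - 0 - y.
    by apply: cvgB => //; apply: cvgB => //; exact: cvg_cst.
  rewrite subr0; apply: (closed_cvg Z Zsub.2).
  apply: filterE => n; rewrite /rem opprB addrA [v + _]addrC addrK.
  by rewrite addrAC subrr add0r; exact: (sYZ n).2.
- by rewrite addrC subrK.
- by have := yr 0%N; rewrite /= subr0 expr0 mulr1.
Qed.

End bounded_decomposition.

(** * Minimizing sequences *)

Lemma cvg_seq_ubound (R : realType) (u : nat -> R) (l : R) :
  u n @[n --> \oo] --> l -> exists M, forall n, u n <= M.
Proof.
move=> /cvgP/cvg_seq_bounded/bounded_fun_has_ubound[M MP].
by exists M => n; apply: MP; exists n.
Qed.

Section convex_hull.
Variables (R : realType) (V : lmodType R).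

(** As an intersection of convex sets, the hull inherits any property of [A] that defines a convex
    set, and explicit combinations never appear. *)
Definition hull (A : set V) : set V :=
  [set x | forall C, is_convex C -> A `<=` C -> C x].

Lemma hull_convex A : is_convex (hull A).
Proof.
apply/convex_setP => t x y t01 Ax Ay C cvxC AC; move/convex_setP: (cvxC).
by apply => //; [exact: Ax|exact: Ay].
Qed.

Lemma sub_hull A : A `<=` hull A.
Proof. by move=> x Ax C _; exact. Qed.

End convex_hull.

Section cmc_functions.
Variables (R : realType) (N : nat) (f : 'rV[R]_N -> R).
Hypothesis fcmc : cmc f.

Lemma cmc_conv t phi psi : 0 <= t <= 1 -> orthant phi -> orthant psi ->
  f (t *: phi + (1 - t) *: psi) <= t * f phi + (1 - t) * f psi.
Proof.
move=> /andP[t0 t1] ophi opsi.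
by apply: (cmc_convex fcmc (Itv01 t0 t1)); exact: mem_set.
Qed.

(* By convexity, [f (psi + d)] lies below the chord from [f psi] to
   [f (psi + 1)], and the latter value is bounded by monotonicity. *)
Lemma cmc_unif_upper_semicontinuous (B e : R) : 0 < e ->
  exists2 d, 0 < d & forall psi, orthant psi -> (forall i, psi 0 i <= B) ->
    f (psi + const_mx d) <= f psi + e.
Proof.
(* [K] bounds [f (psi + 1)] by monotonicity; [|B|] keeps the point in the orthant even for negative
   [B]. *)
move=> e0; pose K := f (const_mx (`|B| + 1)).
have oK : orthant (const_mx (`|B| + 1) : 'rV[R]_N).
  by move=> i; rewrite mxE addr_ge0.
have K0 : 0 <= K by exact: cmc_ge0.
(* [d <= 1] makes [d] a convex weight, and [d K <= e] bounds the rise along the chord. *)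
pose d := Num.min 1 (e / (K + 1)).
have d0 : 0 < d by rewrite lt_min ltr01 divr_gt0// ltr_wpDl.
have d1 : d <= 1 by rewrite ge_min lexx.
have de : d * (K + 1) <= e.
  by rewrite -ler_pdivlMr ?ltr_wpDl// ge_min lexx orbT.
exists d => // psi opsi psiB.
have opsi1 : orthant (psi + const_mx 1).
  by move=> i; rewrite !mxE addr_ge0.
have -> : psi + const_mx d = d *: (psi + const_mx 1) + (1 - d) *: psi.
  by apply/rowP => i; rewrite !mxE; ring.
apply: le_trans (cmc_conv _ opsi1 opsi) _; first by rewrite ltW.
have f1K : f (psi + const_mx 1) <= K.
  apply: cmc_monotone => // i; rewrite !mxE lerD2r.
  by apply: le_trans (psiB i) _; exact: ler_norm.
have f0 := cmc_ge0 fcmc opsi.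
have : d * f (psi + const_mx 1) <= d * K by rewrite ler_pM2l.
have : 0 <= d * f psi by rewrite mulr_ge0// ltW.
by lra.
Qed.

Variables (X : normedModType R) (x : 'I_N -> X).

Lemma orthant_dist v : orthant (\row_i `|v - x i| : 'rV[R]_N).
Proof. by move=> i; rewrite mxE. Qed.

Lemma r_ge0 v : 0 <= r_ f v x.
Proof. by apply: cmc_ge0 => //; exact: orthant_dist. Qed.

(** Each distance is convex in the point; monotonicity carries this into [f], whose convexity
    finishes. *)
Lemma r_convex t u v : 0 <= t <= 1 ->
  r_ f (t *: u + (1 - t) *: v) x <= t * r_ f u x + (1 - t) * r_ f v x.
Proof.
move=> t01; have /andP[t0 t1] := t01; have t'0 : 0 <= 1 - t by rewrite subr_ge0.
apply: le_trans (cmc_conv t01 (orthant_dist u) (orthant_dist v)).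
apply: cmc_monotone => //; first exact: orthant_dist.
  by move=> i; rewrite !mxE addr_ge0// mulr_ge0.
move=> i; rewrite !mxE.
have -> : t * `|u - x i| + (1 - t) * `|v - x i| =
    `|t *: (u - x i)| + `|(1 - t) *: (v - x i)|.
  by rewrite !normrZ (ger0_norm t0) (ger0_norm t'0).
apply: le_trans (ler_normD _ _).
rewrite le_eqVlt; apply/predU1P; left.
congr (`| _ |).
by rewrite !scalerBr addrACA -opprD -scalerDl [t + _]addrC subrK scale1r.
Qed.

Lemma r_bounded (v : nat -> X) (M : R) (i : 'I_N) :
  (forall n, r_ f (v n) x <= M) -> exists B, forall n i, `|v n - x i| <= B.
Proof.
(* Level [M + 1], because coercivity gives a non-strict bound, which at level [M] would not
   contradict [rM]. *)
move=> rM; have [K KP] := cmc_coercive fcmc (M + 1).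
exists K => n j.
have vK : `|\row_i `|v n - x i| : 'rV[R]_N| <= K.
  rewrite leNgt; apply/negP => /ltW /(KP _ (orthant_dist _)).
  by have := rM n; rewrite /r_; lra.
apply: le_trans vK; rewrite [leRHS]mx_normrE.
by apply: le_trans (le_bigmax _ _ (0, j)); rewrite /= mxE normr_id.
Qed.

Lemma rad_le (V : set X) v : V v -> Defs.rad V f x <= r_ f v x.
Proof.
move=> Vv; apply: ge_inf; last by exists v.
by exists 0 => _ [u _ <-]; exact: r_ge0.
Qed.

End cmc_functions.

(** Approximating [F - y] from [Z] amounts to approximating [F] from [y + Z]. *)
Lemma r_translate (R : realType) (N : nat) (f : 'rV[R]_N -> R)
    (X : normedModType R) (x : 'I_N -> X) (y v : X) :
  r_ f v (fun i => x i - y) = r_ f (y + v) x.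
Proof.
by congr f; apply/rowP => i; rewrite !mxE opprB addrA [v + y]addrC.
Qed.

Section sum_minimizing.
Variables (R : realType) (X : normedModType R) (Y Z : set X).
Hypothesis Zsub : closed_subspace Z.
Hypothesis ZSACP : weak_cmc_SACP Z.
Variables (F : set X) (N : nat) (x : 'I_N -> X) (f : 'rV[R]_N -> R).
Hypotheses (F0 : finite_nonempty F) (xF : set_bij [set: 'I_N] F x).
Hypothesis fcmc : cmc f.
Variables (y z : nat -> X) (b : X).
Hypothesis Zz : forall n, Z (z n).
Hypothesis yzcvg :
  r_ f (y n + z n) x @[n --> \oo] --> Defs.rad (set_sum Y Z) f x.
Hypotheses (Yb : Y b) (yb : tail_point y b).

(* Convex combinations of tails of [(y n, z n)] whose first components tend
   to [b] in norm. *)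
Let near_minimizer (n : nat) : exists z', [/\ Z z',
  r_ f (b + z') x <= Defs.rad (set_sum Y Z) f x + 2 * n.+1%:R^-1 &
  forall (phi : {linear X -> R^o}) a,
    (forall m, (n <= m)%N -> a <= phi (z m)) -> a <= phi z'].
Proof.
have := yzcvg; set R0 := Defs.rad _ _ _ => rcvg.
set e := n.+1%:R^-1 : R; have e0 : 0 < e by rewrite invr_gt0.
have [M rM] := cvg_seq_ubound rcvg.
have [B0 BP] : exists B, forall n i, `|y n + z n - x i| <= B.
  have [_ [p Fp]] := F0; have [_ _ /(_ p Fp)[i _ _]] := xF.
  exact: (r_bounded fcmc i rM).
have [d d0 dP] := cmc_unif_upper_semicontinuous fcmc B0 e0.
have /cvgrPdist_le/(_ e e0)[n0 _ n0P] := rcvg.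
(* Pairs keep the same convex weights on both components. Indices beyond [n] serve the half-space
   condition, those beyond [n0] the bound by [R0 + e]. *)
pose A : set (X * X) :=
  [set p | exists2 m, (maxn n n0 <= m)%N & p = (y m, z m)].
have An m : (maxn n n0 <= m)%N -> hull A (y m, z m).
  by move=> nm; apply: sub_hull; exists m.
have [|||_ [[y' z'] Ap <-] /= y'b] := @mazur _ _ (fst @` hull A) b _ _ _ d d0.
- apply/convex_setP => t _ _ t01 [p Ap <-] [q Aq <-].
  exists (t *: p + (1 - t) *: q) => //.
  by move/convex_setP: (@hull_convex _ _ A); apply.
- by exists (y (maxn n n0)), (y (maxn n n0), z (maxn n n0)) => //; exact: An.
- move=> phi cphi a aA; apply: (yb cphi (N := maxn n n0)) => m nm.
  by apply: aA; exists (y m, z m) => //; exact: An.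
(* Each property of [(y', z')] below holds on [A] and defines a convex set of pairs, so it passes to
   the hull. *)
have Zz' : Z z'.
  apply: (Ap [set p | Z p.2]) => [|_ [m _ ->]//=].
  apply/convex_setP => t p q t01 /= Zp Zq.
  by move/convex_setP: (subspace_convex Zsub); apply.
have rz' : r_ f (y' + z') x <= R0 + e.
  apply: (Ap [set p | r_ f (p.1 + p.2) x <= R0 + e]).
    apply/convex_setP => t [p1 p2] [q1 q2] t01 /= rp rq.
    rewrite addrACA -!scalerDr; apply: le_trans (r_convex fcmc x _ _ t01) _.
    have /andP[t0 t1] := t01.
    have : t * r_ f (p1 + p2) x <= t * (R0 + e) by rewrite ler_wpM2l.
    have : (1 - t) * r_ f (q1 + q2) x <= (1 - t) * (R0 + e).
      by rewrite ler_wpM2l// subr_ge0.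
    by lra.
  move=> _ [m nm ->] /=.
  have := n0P m (leq_trans (leq_maxr _ _) nm).
  by rewrite /= ler_norml => /andP[+ _]; lra.
have Bz' i : `|y' + z' - x i| <= B0.
  apply: (Ap [set p | `|p.1 + p.2 - x i| <= B0]) => [|_ [m _ ->]/=]; last first.
    exact: BP.
  apply/convex_setP => t [p1 p2] [q1 q2] /andP[t0 t1] /= Bp Bq.
  have -> : t *: p1 + (1 - t) *: q1 + (t *: p2 + (1 - t) *: q2) - x i =
      t *: (p1 + p2 - x i) + (1 - t) *: (q1 + q2 - x i).
    rewrite !scalerBr !scalerDr addrACA [in RHS]addrACA -opprD -scalerDl.
    by rewrite [t + _]addrC subrK scale1r.
  apply: le_trans (ler_normD _ _) _.
  rewrite !normrZ ger0_norm// ger0_norm ?subr_ge0//.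
  have : t * `|p1 + p2 - x i| <= t * B0 by rewrite ler_wpM2l.
  have : (1 - t) * `|q1 + q2 - x i| <= (1 - t) * B0.
    by rewrite ler_wpM2l// subr_ge0.
  by lra.
exists z'; split=> //.
  (* One [e] comes from [rz'], the other from replacing [y'] by [b]: this raises each distance by at
     most [d], hence the value of [f] by at most [e]. *)
  apply: (@le_trans _ _ (R0 + e + e)); last by lra.
  apply: (@le_trans _ _ (r_ f (y' + z') x + e)); last by rewrite lerD2r.
  apply: le_trans (dP _ (orthant_dist x (y' + z')) _); last first.
    by move=> i; rewrite mxE.
  apply: (cmc_monotone fcmc); first exact: orthant_dist.
    by move=> i; rewrite !mxE addr_ge0// ltW.
  move=> i; rewrite !mxE -lerBlDl.
  apply: le_trans (lerB_dist _ _) _.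
  rewrite opprB addrA subrK opprD addrACA subrr addr0 distrC; exact: ltW.
move=> phi a az; apply: (Ap [set p | a <= phi p.2]).
  apply/convex_setP => t p q /andP[t0 t1] /= ap aq; rewrite linearD !linearZ /=.
  have : t * a <= t * phi p.2 by rewrite ler_wpM2l.
  have : (1 - t) * a <= (1 - t) * phi q.2 by rewrite ler_wpM2l// subr_ge0.
  by rewrite /GRing.scale/=; lra.
by move=> _ [m nm ->]; apply: az; exact: leq_trans (leq_maxl _ _) nm.
Qed.

(** As [b + Z] is part of [Y + Z], the radius of [F] from [Y + Z] is at most that of [F - b] from
    [Z], so the points [z' n] minimize in [Z]. A weak subsequential limit of them is a tail point of
    [z], because [z' n] lies in every half-space containing the tail of [z] from [n] on. *)
Lemma minimizing_tail_point : exists c, tail_point z c.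
Proof.
have /choice[z' z'P] := near_minimizer.
pose x' i := x i - b.
have injx : set_inj [set: 'I_N] x by have [] := xF.
have rad_le_rad : Defs.rad (set_sum Y Z) f x <= Defs.rad Z f x'.
  apply: lb_le_inf; first by exists (r_ f 0 x'), 0 => //; exact: subspace0.
  move=> _ [u Zu <-]; rewrite r_translate; apply: rad_le => //.
  by exists b => //; exists u.
have [|||k [c [k_mono kc]]] :=
    @ZSACP (x' @` [set: 'I_N]) _ N x' _ f fcmc z'
      (fun n => let: And3 Zn _ _ := z'P n in Zn).
- split; first exact: finite_image.
  have [_ [p Fp]] := F0; have [_ _ /(_ p Fp)[i _ _]] := xF.
  by exists (x' i), i.
- split; [by move=> i _; exists i| |by move=> _ [i _ <-]; exists i].
  by move=> i j iT jT /addIr; exact: injx.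
- apply: (@squeeze_cvgr _ _ _ _ (cst (Defs.rad Z f x'))
      (fun n => Defs.rad Z f x' + 2 * n.+1%:R^-1)).
  + apply: filterE => n; have [Zn rn _] := z'P n.
    rewrite rad_le//= r_translate; apply: le_trans rn _.
    by rewrite lerD2r.
  + exact: cvg_cst.
  + rewrite -[X in _ --> X]addr0; apply: cvgD; first exact: cvg_cst.
    rewrite -[X in _ --> X](mulr0 2); apply: cvgMr.
    exact: cvg_harmonic.
exists c => phi cphi a n0 an0.
apply: (weakly_cvg_tail_point kc cphi (N := n0)) => n n0n /=.
have [_ _ /(_ phi a)] := z'P (k n); apply => m km; apply: an0.
exact: leq_trans (leq_trans n0n (homo_ltn_geq n k_mono)) km.
Qed.

End sum_minimizing.

Lemma weakly_cvg_subseq (R : realType) (X : normedModType R) (u : nat -> X)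
    (l : X) (k : nat -> nat) :
  {homo k : m n / (m < n)%N} -> weakly_cvg_to u l -> weakly_cvg_to (u \o k) l.
Proof.
move=> k_mono ul phi cphi.
exact: cvg_comp (homo_ltn_cvg k_mono) (ul phi cphi).
Qed.

Lemma weakly_cvgD (R : realType) (X : normedModType R) (u v : nat -> X)
    (l m : X) :
  weakly_cvg_to u l -> weakly_cvg_to v m ->
  weakly_cvg_to (fun n => u n + v n) (l + m).
Proof.
move=> ul vm phi cphi; rewrite linearD.
under eq_fun do rewrite linearD.
by apply: cvgD; [exact: ul|exact: vm].
Qed.

Unset Implicit Arguments.

Theorem theorem3p14 (R : realType) (X : completeNormedModType R) (Y Z : set X)
    (Ysub : closed_subspace Y) (Yrefl : reflexive_subspace Y)
    (Zsub : closed_subspace Z) (YZclosed : closed (set_sum Y Z))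
    (ZSACP : weak_cmc_SACP Z) :
  weak_cmc_SACP (set_sum Y Z).
Proof.
move=> F F0 N x xF f fcmc v Wv vcvg.
have [C CP] := bounded_decomposition Ysub Zsub YZclosed.
have /choice[p pP] n : exists p : X * X,
    [/\ Y p.1, Z p.2, v n = p.1 + p.2 & `|p.1| <= C * `|v n|].
  by have [y [z [? ? ? ?]]] := CP _ (Wv n); exists (y, z).
pose y n := (p n).1; pose z n := (p n).2.
have Yy n : Y (y n) by have [] := pP n.
have Zz n : Z (z n) by have [] := pP n.
have vyz n : v n = y n + z n by have [] := pP n.
have [V0 vV0] : exists V0, forall n, `|v n| <= V0.
  have [M rM] := cvg_seq_ubound vcvg.
  have [_ [q Fq]] := F0; have [_ _ /(_ q Fq)[i _ _]] := xF.
  have [B BP] := r_bounded fcmc i rM; exists (B + `|x i|) => n.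
  rewrite -[v n](subrK (x i)); apply: le_trans (ler_normD _ _) _.
  by rewrite lerD2r.
(* The absolute value is taken because the sign of [C] is not known. *)
pose M := `|C| * V0.
have yM n : `|y n| <= M.
  have [_ _ _ /le_trans] := pP n; apply; apply: le_trans (ler_norm _) _.
  by rewrite normrM normr_id ler_wpM2l.
have zM n : `|z n| <= V0 + M.
  have -> : z n = v n - y n by rewrite vyz addrAC subrr add0r.
  by apply: le_trans (ler_normB _ _) _; exact: lerD.
have [k [b [k_mono kb]]] : has_weakly_cvg_subseq y.
  apply: (bounded_tail_points_weakly_cvg yM) => k _.
  apply: (reflexive_tail_point Ysub Yrefl (M := M)) => n /=; first exact: Yy.
  exact: yM.
(* This is what places [b + Z] inside [Y + Z]. *)
have Yb : Y b.
  apply: tail_point_mem (subspace_convex Ysub) Ysub.2 _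
    (weakly_cvg_tail_point kb).
  by move=> n; exact: Yy.
have [k' [c [k'_mono kc]]] : has_weakly_cvg_subseq (z \o k).
  apply: (bounded_tail_points_weakly_cvg (M := V0 + M)) => [n|j j_mono].
    exact: zM.
  (* Along [k \o j] the sums still minimize and the [Y] parts still tend weakly to [b], so [b] is a
     tail point of them. *)
  apply: (minimizing_tail_point Zsub ZSACP F0 xF fcmc
      (Y := Y) (y := y \o k \o j) (b := b)) => //.
  - by move=> n; exact: Zz.
  - have kj_mono : {homo k \o j : m n / (m < n)%N} by move=> m n /j_mono/k_mono.
    rewrite [X in fmap X](_ : _ = (fun n => r_ f (v n) x) \o (k \o j)).
      exact: cvg_comp (homo_ltn_cvg kj_mono) vcvg.
    by apply/funext => n /=; rewrite vyz.
  - exact/weakly_cvg_tail_point/weakly_cvg_subseq.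
exists (k \o k'), (b + c); split; first by move=> m n /k'_mono/k_mono.
rewrite (_ : v \o _ = fun n => (y \o k \o k') n + (z \o k \o k') n); last first.
  by apply/funext => n /=; exact: vyz.
by apply: weakly_cvgD => //; exact: weakly_cvg_subseq.
Qed.
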